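(* Under the Gaussian copula model, fix $m\in\mathbb N$, $\alpha\in(0,1]$ and $\rho\in(0,1]$. Then: (a) for all integers $n,n'$ with $m\le n\le n'$, $$p^{\mathrm{G}}_{\mathrm{success}}(n,m,\alpha,\rho)\le p^{\mathrm{G}}_{\mathrm{success}}(n',m,\alpha,\rho);$$ (b) $\displaystyle\lim_{n\to\infty}p^{\mathrm{G}}_{\mathrm{success}}(n,m,\alpha,\rho)=1.$
   Context: Ordinal optimisation model: let $(Z_1,X_1),\dots,(Z_n,X_n)$ be i.i.d. copies of a pair $(Z,X)$ of real random variables. Order $Z_1,\dots,Z_n$ increasingly as $Z_{1:n}\le\dots\le Z_{n:n}$ and let $X_{\langle i\rangle}$ denote the $X$-value paired with $Z_{i:n}$. Let $x^*_\alpha$ be the $\alpha$-quantile of $X$. The success probability is $\Pr(\min_{1\le i\le m}X_{\langle i\rangle}\le x^*_\alpha)$. Gaussian copula model with correlation $\rho$: $Z,X$ have continuous marginal CDFs $F_Z,F_X$ and joint CDF $\boldsymbol\Phi_{\rho}(\Phi^{-1}(F_Z(z)),\Phi^{-1}(F_X(x)))$, with $\Phi$ the standard normal CDF and $\boldsymbol\Phi_\rho$ the standard bivariate normal CDF with correlation $\rho$. The success probability in this model is $p^{\mathrm{G}}_{\mathrm{success}}(n,m,\alpha,\rho)$. *)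

(* Defs.v *)
From HB Require Import structures.
From mathcomp Require Import all_boot all_order all_algebra.
From mathcomp Require Import all_classical all_reals all_analysis.
Set Implicit Arguments. Unset Strict Implicit. Unset Printing Implicit Defensive.
Import Order.TTheory GRing.Theory Num.Theory Num.Def.
Import numFieldNormedType.Exports.
Local Open Scope classical_set_scope.
Local Open Scope ring_scope.

Section gauss_copula.
Context {R : realType}.

Definition stdN : set R -> \bar R := normal_prob 0 1.

Definition Phi (t : R) : \bar R := stdN [set s : R | s <= t].

(* generalized inverse of Phi, with values in the extended reals:
   Phi^{-1}(u) = inf {t | Phi t >= u}  (so Phi^{-1}(0) = -oo, Phi^{-1}(1) = +oo) *)
Definition Phi_inv (u : R) : \bar R :=
  ereal_inf [set t%:E | t in [set t : R | (u%:E <= Phi t)%E]].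

(* standard bivariate normal CDF with correlation rho, evaluated at extended
   reals: law of (U, rho U + sqrt(1-rho^2) V) with U, V i.i.d. N(0,1) *)
Definition Phi2 (rho : R) (a b : \bar R) : \bar R :=
  ((stdN \x stdN)%E
     [set p : R * R | (p.1%:E <= a)%E /\
                      ((rho * p.1 + Num.sqrt (1 - rho ^+ 2) * p.2)%:E <= b)%E]).

Definition quantile (F : R -> R) (alpha : R) : \bar R :=
  ereal_inf [set x%:E | x in [set x : R | alpha <= F x]].

(* index of the pairs, sorted increasingly according to the Z-values
   (stable sort; ties, a null event, broken by index) *)
Definition Zorder (Zs : nat -> R) (n : nat) : seq nat :=
  sort (fun i k => Zs i <= Zs k) (iota 0 n).

Context {d : measure_display} {T : measurableType d}.

Definition indep_pairs (P : probability T R) (Z X : nat -> T -> R) : Prop :=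
  forall (n : nat) (z x : nat -> R),
    P [set w | forall i, (i < n)%N -> Z i w <= z i /\ X i w <= x i] =
    \big[*%E/1%E]_(i < n) P [set w | (Z i w <= z i)%R /\ (X i w <= x i)%R].

Definition gaussian_copula_iid (P : probability T R) (Z X : nat -> T -> R)
    (FZ FX : R -> R) (rho : R) : Prop :=
  (forall i, measurable_fun setT (Z i)) /\
  (forall i, measurable_fun setT (X i)) /\
  indep_pairs P Z X /\
  continuous FZ /\ continuous FX /\
  (forall i z, P [set w | Z i w <= z] = (FZ z)%:E) /\
  (forall i x, P [set w | X i w <= x] = (FX x)%:E) /\
  (forall i z x, P [set w | Z i w <= z /\ X i w <= x] =
                 Phi2 rho (Phi_inv (FZ z)) (Phi_inv (FX x))).

Definition p_success (P : probability T R) (Z X : nat -> T -> R)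
    (FX : R -> R) (n m : nat) (alpha : R) : \bar R :=
  P [set w | (\big[Order.min/+oo%E]_(j <- take m (Zorder (fun i => Z i w) n))
                 (X j w)%:E <= quantile FX alpha)%E].

End gauss_copula.

(* Main.v *)
Require Import Defs.
From HB Require Import structures.
From mathcomp Require Import all_boot all_order all_algebra.
From mathcomp Require Import all_classical all_reals all_analysis.
From mathcomp Require Import lra.
Import Order.TTheory GRing.Theory Num.Theory Num.Def.
Import numFieldNormedType.Exports.
Set Implicit Arguments. Unset Strict Implicit. Unset Printing Implicit Defensive.
Local Open Scope classical_set_scope.
Local Open Scope ring_scope.

(** Let [q] be the quantile. Cut the range of [Z] into [N] cells of probability [1/N] and keep, for
    each pair, only its cell and whether [X <= q]. Unless two of the [n] points share a cell, which
    has probability at most [n^2/N], the order of the [Z]'s is the order of the cells. Up to this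
    error the failure probability is the average over cell configurations of the product of
    [g c = P (X > q | cell c)] over the [m] lowest cells. As [rho > 0], the fibres over [u] of the
    half-plane [rho u + sqrt (1 - rho^2) v <= b] shrink when [u] grows, so [g] is nondecreasing;
    extra points only lower the order statistics of the cells, hence the product, and [N --> oo]
    gives (a). For (b), [g c <= eps] on the cells in some fixed left tail of [Z], and the lowest of
    [n] points misses that tail with geometrically small probability. *)

(** * The finite model *)

Definition lowest (e : rel nat) (m n : nat) : seq nat := take m (sort e (iota 0 n)).

(** Induction along [t]. The head of [s] occurs in the sorted list [t], so it is at least the head
    of [t], and the tail of [s] is a subsequence of the tail of [t] whether or not the heads agree.
    The factors are nonnegative, so the inequalities multiply. *)
Lemma prod_take_subseq (R : realFieldType) (N : nat) (g : nat -> R)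
    (s t : seq nat) (m : nat) :
  (forall v, (v < N)%N -> 0 <= g v <= 1) ->
  (forall u v, (u <= v < N)%N -> g u <= g v) ->
  {in t, forall v, (v < N)%N} -> sorted leq t -> subseq s t -> (m <= size s)%N ->
  \prod_(v <- take m t) g v <= \prod_(v <- take m s) g v.
Proof.
move=> g01 gmono; elim: t s m => [|y t IH] s m tN st.
  by rewrite subseq0 => /eqP ->.
case: m => [|m]; first by rewrite !take0.
case: s => [//|x s] sst; rewrite /= ltnS => ms.
have xyt : x \in y :: t by apply: (mem_subseq sst); rewrite mem_head.
have yx : (y <= x)%N.
  move: xyt; rewrite inE => /predU1P[-> //|xt].
  by move: st => /= /(order_path_min leq_trans)/allP/(_ _ xt).
have sst' : subseq s t.
  move: sst => /=; case: eqP => // _ h; apply: subseq_trans h; exact: subseq_cons.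
have {}IH := IH s m _ _ sst' ms.
rewrite !big_cons; apply: ler_pM.
- by have /andP[] := g01 y (tN y (mem_head _ _)).
- rewrite big_seq; apply: prodr_ge0 => v /mem_take vt.
  by have /andP[] // : 0 <= g v <= 1; apply/g01/tN; rewrite inE vt orbT.
- by apply: gmono; rewrite yx tN.
- apply: IH; last exact: path_sorted st.
  by move=> v vt; rewrite tN// inE vt orbT.
Qed.

Section discrete_model.
Variables (R : realFieldType) (N' M' : nat).
Notation N := N'.+1.
Notation M := M'.+1.
Variables (w0 : nat -> R).
Let p : R := N%:R^-1.
Hypothesis w0_bound : forall v, (v < N)%N -> 0 <= w0 v <= p.
Hypothesis w0_mono : forall u v, (u <= v < N)%N -> w0 u <= w0 v.
Implicit Types (c : {ffun 'I_M -> 'I_N}) (b : {ffun 'I_M -> bool}).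

Definition cellrel c : rel nat := fun i k => (c (inord i) <= c (inord k))%N.

(** The sample has [M] points and only the first [n] are ranked, so that all [n <= M] live on one
    sample space. The mark [true] stands for [X <= q]. *)
Definition bad (m n : nat) c b : bool :=
  [forall i : 'I_M, ((i : nat) \in lowest (cellrel c) m n) ==> ~~ b i].

(** Joint law of cell and mark: each cell has mass [1/N], of which [w0 v] belongs to [X > q]. Hence
    the [g v] below is the conditional probability of [X > q] in cell [v]. *)
Definition mark_weight (v : nat) (x : bool) : R :=
  if x then N%:R^-1 - w0 v else w0 v.

Definition config_weight c b : R := \prod_(i < M) mark_weight (c i) (b i).

Definition bad_prob (m n : nat) : R :=
  \sum_(c : {ffun 'I_M -> 'I_N}) \sum_(b : {ffun 'I_M -> bool}) config_weight c b * (bad m n c b)%:R.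

Let p_gt0 : 0 < p. Proof. by rewrite invr_gt0. Qed.

Let g v := w0 v / p.
Let g01 v : (v < N)%N -> 0 <= g v <= 1.
Proof.
by move=> /w0_bound/andP[? ?]; rewrite divr_ge0 ?(ltW p_gt0)//= ler_pdivrMr ?mul1r.
Qed.
Let g_mono u v : (u <= v < N)%N -> g u <= g v.
Proof. by move=> /w0_mono uv; rewrite ler_pM2r ?invr_gt0. Qed.

Let cells c n := map (fun i => c (inord i) : nat) (iota 0 n).

(** The indicator is a product over the points, so the sum over marks factorises: a point in [A] is
    forced to the mark [false], any other contributes its whole cell mass. *)
Lemma config_weight_sum c (A : pred 'I_M) :
  \sum_(b : {ffun 'I_M -> bool}) config_weight c b * [forall i, A i ==> ~~ b i]%:R =
  \prod_i (if A i then w0 (c i) else p).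
Proof.
transitivity (\sum_(b : {ffun 'I_M -> bool}) \prod_i (mark_weight (c i) (b i) * (A i ==> ~~ b i)%:R)).
  apply: eq_bigr => b _; rewrite big_split/=; congr (_ * _).
  case: forallP => [h|/forallP]; first by rewrite big1// => i _; rewrite h.
  by rewrite negb_forall => /existsP[i /negbTE h]; rewrite (bigD1 i)//= h mul0r.
rewrite -(bigA_distr_bigA (fun i x => mark_weight (c i) x * (A i ==> ~~ x)%:R)).
apply: eq_bigr => i _; rewrite big_bool/= /mark_weight.
by case: (A i) => /=; rewrite ?mulr0 ?mulr1 ?add0r// subrK.
Qed.

(** Each of the [M] points gives a factor [p], and the lowest ones an extra factor [g]. Sorting the
    indices by cell and then reading off the cells amounts to sorting the cells. *)
Lemma bad_probE m n : (n <= M)%N ->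
  bad_prob m n = \sum_(c : {ffun 'I_M -> 'I_N}) p ^+ M * \prod_(v <- take m (sort leq (cells c n))) g v.
Proof.
move=> nM; apply: eq_bigr => c _.
rewrite /bad (config_weight_sum c (fun i => (i : nat) \in lowest (cellrel c) m n)).
have -> : take m (sort leq (cells c n)) =
    map (fun i => c (inord i) : nat) (lowest (cellrel c) m n).
  by rewrite map_take /cells sort_map.
rewrite big_map.
(* This turns the product over the list of lowest indices into one over ordinals; [n <= M] ensures
   that all these indices are below [M]. *)
have pm : perm_eq [seq i <- index_iota 0 M | i \in lowest (cellrel c) m n]
            (lowest (cellrel c) m n).
  have ul : uniq (lowest (cellrel c) m n) by rewrite take_uniq// sort_uniq iota_uniq.
  apply: uniq_perm => //; first by rewrite filter_uniq// iota_uniq.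
  move=> i; rewrite mem_filter mem_index_iota /=; case: (boolP (i \in _)) => //= /mem_take.
  by rewrite mem_sort mem_iota /= add0n => /leq_trans; exact.
rewrite -(perm_big _ pm) big_filter /= big_mkord.
have -> : p ^+ M = \prod_(i < M) p by rewrite prodr_const card_ord.
rewrite [X in _ = _ * X]big_mkcond -big_split /=; apply: eq_bigr => i _.
rewrite inord_val; case: ifP => _; last by rewrite mulr1.
by rewrite /g mulrCA divff ?gt_eqF// mulr1.
Qed.

Lemma cells_lt c n : {in sort leq (cells c n), forall v, (v < N)%N}.
Proof. by move=> v; rewrite mem_sort => /mapP[i _ ->]; exact: ltn_ord. Qed.

(** Configuration by configuration: the sorted cells of the first [n] points form a subsequence of
    those of the first [n'], so [prod_take_subseq] applies. *)
Lemma bad_prob_nonincreasing m n n' : (m <= n)%N -> (n <= n')%N -> (n' <= M)%N ->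
  bad_prob m n' <= bad_prob m n.
Proof.
move=> mn nn' n'M; rewrite !bad_probE ?(leq_trans nn')//.
apply: ler_sum => c _; rewrite ler_pM2l ?exprn_gt0//.
apply: (@prod_take_subseq _ N) => //.
- exact: cells_lt.
- exact/sort_sorted/leq_total.
- apply: subseq_sort; [exact: leq_total|exact: leq_trans|].
  by apply: map_subseq; rewrite -(subnKC nn') iotaD prefix_subseq.
- by rewrite size_sort size_map size_iota.
Qed.

(** If some cell is at most [v0], so is the smallest one, whose factor alone bounds the product by
    [g v0]. Otherwise all [M] points lie above [v0], an event whose probability is the second
    term. *)
Lemma bad_prob_le m v0 : (0 < m <= M)%N -> (v0 < N)%N ->
  bad_prob m M <= g v0 + (1 - v0.+1%:R / N%:R) ^+ M.
Proof.
move=> /andP[m0 mM] v0N; rewrite bad_probE//.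
have key c : \prod_(v <- take m (sort leq (cells c M))) g v <=
    g v0 + \prod_i (v0 < c i)%:R.
  have hN := @cells_lt c M.
  have hs : sorted leq (sort leq (cells c M)) by exact/sort_sorted/leq_total.
  have hm : forall i : 'I_M, (c i : nat) \in sort leq (cells c M).
    move=> i; rewrite mem_sort; apply/mapP; exists (i : nat).
      by rewrite mem_iota add0n /=.
    by rewrite inord_val.
  case: (sort leq (cells c M)) hN hs hm => [|y t] hN hs hm.
    by have := hm ord0.
  case: m m0 mM => // m _ _; rewrite /= big_cons.
  have h01 : \prod_(v <- take m t) g v <= 1.
    rewrite big_seq; apply: prodr_ile1 => v /mem_take vt.
    by apply: g01; apply: hN; rewrite inE vt orbT.
  have gy := g01 (hN y (mem_head _ _)); have /andP[gy0 gy1] := gy.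
  apply: (@le_trans _ _ (g y)); first by rewrite -[leRHS]mulr1 ler_wpM2l.
  case: (boolP [forall i, v0 < c i]%N) => [/forallP h|].
    rewrite [X in _ + X]big1 => [|i _]; last by rewrite h.
    by have /andP[? ?] := g01 v0N; rewrite (le_trans gy1)// lerDr.
  rewrite negb_forall => /existsP[i]; rewrite -leqNgt => civ0.
  rewrite -[leLHS]addr0; apply: lerD; last by apply: prodr_ge0.
  apply: g_mono; rewrite v0N andbT (leq_trans _ civ0)//.
  have := hm i; rewrite inE => /predU1P[-> //|it].
  by move: hs => /= /(order_path_min leq_trans)/allP/(_ _ it).
apply: (@le_trans _ _ (\sum_(c : {ffun 'I_M -> 'I_N}) p ^+ M * (g v0 + \prod_i (v0 < c i)%:R))).
  by apply: ler_sum => c _; rewrite ler_pM2l ?exprn_gt0.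
under eq_bigr do rewrite mulrDr.
rewrite big_split /= sumr_const card_ffun !card_ord.
rewrite -[in leLHS]mulrnAl -[_ *+ (N ^ M)]mulr_natr natrX -exprMn mulVf ?pnatr_eq0//.
rewrite expr1n mul1r lerD2l -mulr_sumr.
rewrite -(bigA_distr_bigA (fun i (x : 'I_N) => (v0 < x)%:R)).
rewrite (eq_bigr (fun=> (N - v0.+1)%:R)) => [|i _]; last first.
  rewrite -natr_sum; congr (_%:R).
  rewrite -(big_mkord xpredT (fun x => (v0 < x) : nat)) (@big_cat_nat _ _ _ v0.+1)//=.
  rewrite big_nat_cond big1 ?add0n => [|x /andP[/andP[_ xv] _]]; last first.
    by rewrite ltnNge -ltnS xv.
  rewrite big_nat_cond (eq_bigr (fun=> 1%N)) => [|x /andP[/andP[-> _] _]]//.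
  by rewrite -big_nat_cond sum_nat_const_nat muln1.
rewrite prodr_const card_ord -exprMn natrB// /p mulrBr mulVf ?pnatr_eq0//.
by rewrite (mulrC _^-1).
Qed.

(** Union bound over the ordered pairs of distinct indices: fewer than [M ^ 2] pairs, each sharing a
    cell with probability [1/N]. *)
Lemma noninjective_le :
  \sum_(c : {ffun 'I_M -> 'I_N}) p ^+ M * (~~ injectiveb c)%:R <= (M%:R * M%:R) / N%:R.
Proof.
have h (c : {ffun 'I_M -> 'I_N}) : ((~~ injectiveb c)%:R : R) <=
    \sum_(ij : 'I_M * 'I_M | ij.1 != ij.2) (c ij.1 == c ij.2)%:R.
  case: (boolP (injectiveb c)) => [_|/injectivePn[i [k ik cik]]]; first exact: sumr_ge0.
  by rewrite (bigD1 (i, k))//= cik eqxx lerDl sumr_ge0.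
apply: (@le_trans _ _ (\sum_(c : {ffun 'I_M -> 'I_N}) p ^+ M *
    \sum_(ij : 'I_M * 'I_M | ij.1 != ij.2) (c ij.1 == c ij.2)%:R)).
  by apply: ler_sum => c _; rewrite ler_pM2l ?exprn_gt0.
rewrite -mulr_sumr exchange_big /= mulr_sumr.
have pN : p * N%:R = 1 by rewrite mulVf// pnatr_eq0.
apply: (@le_trans _ _ (\sum_(ij : 'I_M * 'I_M) p)); last first.
  by rewrite sumr_const card_prod !card_ord -[leLHS]mulr_natl natrM.
rewrite [leLHS]big_mkcond; apply: ler_sum => -[i k] _ /=.
case: ifPn => [ik|_]; last exact: ltW.
(* The collision indicator becomes a sum over the common cell [v] of a product over all coordinates,
   so that the sum over [c] factorises; each [v] then contributes [p ^ 2]. *)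
have pairE (c : {ffun 'I_M -> 'I_N}) : ((c i == c k)%:R : R) =
    \sum_(v < N) \prod_j (((j == i) || (j == k)) ==> (c j == v))%:R.
  rewrite (bigD1 (c i))//= [X in _ + X]big1 ?addr0 => [|v vci]; last first.
    by rewrite (bigD1 i)//= eqxx /= eq_sym (negbTE vci) mul0r.
  case: eqP => cik.
    by rewrite big1// => j _; case: eqP => [->|_]; last case: eqP => [->|_];
      rewrite //= ?cik eqxx.
  by rewrite (bigD1 k)//= eqxx orbT /= eq_sym (negbTE (introN eqP cik)) mul0r.
under eq_bigr do rewrite pairE.
rewrite exchange_big /= mulr_sumr.
rewrite [leRHS](_ : p = \sum_(v < N) p ^+ 2); last first.
  by rewrite sumr_const card_ord -[RHS]mulr_natl expr2 mulrA (mulrC N%:R) pN mul1r.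
apply: ler_sum => v _.
have -> : p ^+ M = \prod_(j < M) p by rewrite prodr_const card_ord.
rewrite -(bigA_distr_bigA (fun j (x : 'I_N) => (((j == i) || (j == k)) ==> (x == v))%:R)).
have sum1 : \sum_(x < N) ((x == v)%:R : R) = 1.
  by rewrite (bigD1 v)//= eqxx big1 ?addr0// => x /negbTE ->.
rewrite -big_split /= (bigD1 i)//= (bigD1 k) 1?eq_sym//= !eqxx orbT /= !sum1.
rewrite big1 ?mulr1 ?expr2// => j /andP[ji jk].
by rewrite (negbTE ji) (negbTE jk) /= sumr_const card_ord pN.
Qed.

End discrete_model.

(** * Independence of the sigma-algebras of the pairs *)

Section independence.
Context {R : realType} {d : measure_display} {T : measurableType d}.
Variable P : probability T R.

Definition quadrants (Z X : T -> R) : set (set T) :=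
  [set A | exists z x, A = [set w | Z w <= z /\ X w <= x]].

Lemma measurable_le (f : T -> R) (a : R) :
  measurable_fun setT f -> measurable [set w | f w <= a].
Proof.
move=> mf; rewrite (_ : [set w | _] = setT `&` f @^-1` `]-oo, a]).
  by apply: mf => //; exact: measurable_itv.
by rewrite setTI; apply/seteqP; split => w /=; rewrite in_itv.
Qed.

Lemma quadrants_measurable (Z X : T -> R) :
  measurable_fun setT Z -> measurable_fun setT X ->
  <<s quadrants Z X >> `<=` measurable.
Proof.
move=> mZ mX; apply: smallest_sub; first exact: sigma_algebra_measurable.
by move=> _ [z [x ->]]; apply: measurableI; exact: measurable_le.
Qed.

Lemma quadrants_setI_closed (Z X : T -> R) : setI_closed (quadrants Z X).
Proof.
move=> _ _ [z [x ->]] [z' [x' ->]]; exists (minr z z'), (minr x x').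
apply/seteqP; split => w /=; rewrite !le_min.
  by move=> [[-> ->] [-> ->]].
by move=> [/andP[-> ->] /andP[-> ->]].
Qed.

Lemma bigcup_quadrants (Z X : T -> R) :
  \bigcup_k [set w | Z w <= k%:R /\ X w <= k%:R] = setT.
Proof.
apply/seteqP; split => // w _; exists (Num.bound (maxr `|Z w| `|X w|)) => //=.
have := @archi_boundP _ (maxr `|Z w| `|X w|); rewrite le_max normr_ge0 => /(_ isT)/ltW.
by rewrite ge_max => /andP[]; split; apply: (le_trans (ler_norm _)).
Qed.

Lemma fin_prob (A : set T) : measurable A -> P A \is a fin_num.
Proof. by move=> mA; rewrite fin_num_measure. Qed.

(** Pi-lambda argument: for fixed [C] the measurable sets satisfying the identity form a
    lambda-system, and the quadrants are closed under intersection. *)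
Lemma indep_quadrants_sigma (Z X : T -> R) (C : set T) (r : \bar R) :
  measurable_fun setT Z -> measurable_fun setT X ->
  measurable C -> r \is a fin_num ->
  (forall A, quadrants Z X A -> P (A `&` C) = (P A * r)%E) ->
  forall A, <<s quadrants Z X >> A -> P (A `&` C) = (P A * r)%E.
Proof.
move=> mZ mX mC rfin hq.
pose H := [set A | measurable A /\ P (A `&` C) = (P A * r)%E].
have ndH : ndseq_closed H.
  move=> F ndF HF; have mF i : measurable (F i) by have [] := HF i.
  have mU : measurable (\bigcup_i F i) by exact: bigcup_measurable.
  split=> //.
  have c1 : P \o F @ \oo --> P (\bigcup_n F n) by exact: nondecreasing_cvg_mu.
  have c2 : P \o (fun n => F n `&` C) @ \oo --> P (\bigcup_n (F n `&` C)).
    apply: nondecreasing_cvg_mu => [i||m n mn].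
    - exact: measurableI.
    - by apply: bigcup_measurable => i _; exact: measurableI.
    - by apply/subsetPset; apply: setSI; apply/subsetPset; exact: ndF.
  rewrite setI_bigcupl in c2 *.
  apply: (cvg_unique _ c2) => //.
  rewrite (_ : P \o _ = (fun n => (P \o F) n * r)%E); last first.
    by apply/funext => n /=; have [] := HF n.
  by apply: cvgeZr.
suff : <<s quadrants Z X >> `<=` H by move=> h A /h[].
apply: lambda_system_subset => //; first exact: quadrants_setI_closed.
- split => //.
  (* As [r] is not assumed to be [P C], the whole space is reached as an increasing union of
     quadrants. *)
  + rewrite -(bigcup_quadrants Z X); apply: ndH.
      move=> m n mn; apply/subsetPset => w /= [h1 h2].
      by split; [apply: (le_trans h1)|apply: (le_trans h2)]; rewrite ler_nat.
    move=> k; split; last by apply: hq; exists k%:R, k%:R.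
    by apply: measurableI; exact: measurable_le.
  + move=> A B BA [mA hA] [mB hB]; split; first exact: measurableD.
    have mAC : measurable (A `&` C) by exact: measurableI.
    have mBC : measurable (B `&` C) by exact: measurableI.
    rewrite (_ : _ `&` C = (A `&` C) `\` (B `&` C)); last first.
      apply/seteqP; split=> w /=; first by move=> [[? Bw] ?]; split=> // -[/Bw].
      by move=> [[? ?] BCw]; split=> //; split=> // Bw; exact: BCw.
    rewrite !measureD ?ltey_eq ?fin_prob//.
    rewrite (_ : A `&` C `&` _ = B `&` C); last first.
      by apply/seteqP; split=> w /=; [move=> [] _|move=> [/[dup]/BA]].
    rewrite (_ : A `&` B = B); last by apply/seteqP; split=> w /=; [case|move=> /[dup]/BA].
    by rewrite [X in (X - _)%E]hA [X in (_ - X)%E]hB muleBl//;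
      apply: fin_num_adde_defl; rewrite fin_numN; exact: fin_prob.
- move=> _ [z [x ->]]; split; last by apply: hq; exists z, x.
  by apply: measurableI; exact: measurable_le.
Qed.

(** Quadrants are replaced by sets of the generated sigma-algebras one index at a time: in [claim]
    the indices below [k] are already general and the others still carry quadrants. The passage to
    [k.+1] is [indep_quadrants_sigma], with [C] the event of the other indices. *)
Lemma indep_pairs_sigma (Z X : nat -> T -> R) :
  (forall i, measurable_fun setT (Z i)) -> (forall i, measurable_fun setT (X i)) ->
  indep_pairs P Z X ->
  forall n (A : nat -> set T), (forall i, <<s quadrants (Z i) (X i) >> (A i)) ->
  P [set w | forall i, (i < n)%N -> A i w] = (\prod_(i < n) P (A i))%E.
Proof.
move=> mZ mX ind n.
suff claim k : (k <= n)%N -> forall A : nat -> set T,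
    (forall i, (i < k)%N -> <<s quadrants (Z i) (X i) >> (A i)) ->
    (forall i, (k <= i)%N -> quadrants (Z i) (X i) (A i)) ->
    P [set w | forall i, (i < n)%N -> A i w] = (\prod_(i < n) P (A i))%E.
  move=> A hA.
  (* The claim at [k = n] wants quadrants from [n] on; neither side sees these indices, so any
     quadrant will do. *)
  pose B i := if (i < n)%N then A i else [set w | Z i w <= 0 /\ X i w <= 0].
  transitivity (P [set w | forall i, (i < n)%N -> B i w]).
    by congr (P _); apply/seteqP; split => w /= h i lin; have := h i lin; rewrite /B lin.
  rewrite (claim n)//; first by apply: eq_bigr => i _; rewrite /B ltn_ord.
    by move=> i lin; rewrite /B lin.
  by move=> i; rewrite /B ltnNge => ->; exists 0, 0.
elim: k => [_ A _ hA|k IH kn A hA1 hA2].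
  have /choice[zx hzx] : forall i, exists zx : R * R,
      A i = [set w | Z i w <= zx.1 /\ X i w <= zx.2].
    by move=> i; have [z [x ->]] := hA i isT; exists (z, x).
  have -> : [set w | forall i, (i < n)%N -> A i w] =
    [set w | forall i, (i < n)%N -> Z i w <= (zx i).1 /\ X i w <= (zx i).2].
    by apply/seteqP; split => w /= h i lin; have := h i lin; rewrite hzx.
  by rewrite ind; apply: eq_bigr => i _; rewrite hzx.
pose C := [set w | forall i, (i < n)%N -> i != k -> A i w].
pose r := (\prod_(i < n | i != k :> nat) P (A i))%E.
have mA i : measurable (A i).
  apply: (quadrants_measurable (mZ i) (mX i)).
  by case: (ltnP i k.+1) => [/hA1//|/hA2 h]; exact: sub_sigma_algebra.
have mC : measurable C.
  rewrite (_ : C = \bigcap_(i in [set i | (i < n)%N && (i != k)]) A i).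
    exact: bigcap_measurableType.
  by apply/seteqP; split=> w /= h i; [case/andP; exact: h|move=> ? ?; apply: h; exact/andP].
have rfin : r \is a fin_num.
  rewrite /r; apply: (big_ind (fun x : \bar R => x \is a fin_num)) => //.
    by move=> x y; exact: fin_numM.
  by move=> i _; exact: fin_prob.
have split_set B : [set w | forall i, (i < n)%N -> (if i == k then B else A i) w] = B `&` C.
  apply/seteqP; split=> w /=.
    move=> h; split; first by have := h k kn; rewrite eqxx.
    by move=> i lin /negbTE ik; have := h i lin; rewrite ik.
  by move=> [Bw h] i lin; case: eqP => // /eqP; exact: h.
have split_prod B : (\prod_(i < n) P (if (i : nat) == k then B else A i) = P B * r)%E.
  rewrite (bigD1 (Ordinal kn))//= eqxx; congr (_ * _)%E.
  by apply: eq_big => [//|i /negbTE]; rewrite -val_eqE /= => ->.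
have key B : <<s quadrants (Z k) (X k) >> B -> P (B `&` C) = (P B * r)%E.
  apply: indep_quadrants_sigma => // D qD.
  rewrite -split_set -split_prod.
  rewrite -(IH (ltnW kn) (fun i => if i == k then D else A i)).
  - by [].
  - move=> i ik; case: eqP => [ik'|_]; first by rewrite ik' ltnn in ik.
    by apply: hA1; rewrite ltnS ltnW.
  - move=> i ki; case: eqP => [->|/eqP ik]; first by [].
    by apply: hA2; rewrite ltn_neqAle eq_sym ik.
have := key _ (hA1 k (ltnSn k)); rewrite -split_set -split_prod => h.
transitivity (P [set w | forall i, (i < n)%N -> (if i == k then A k else A i) w]).
  by congr (P _); apply/seteqP; split => w /= + i lin => /(_ i lin); case: eqP => // ->.
by rewrite h; apply: eq_bigr => i _; case: eqP => // ->.
Qed.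

End independence.

(** * Comparison with the finite model *)

(** The sort is moved to the type of indices below [n], on which the two relations are equal as
    functions. *)
Lemma eq_lowest (e e' : rel nat) (m n : nat) :
  (forall i k, (i < n)%N -> (k < n)%N -> e i k = e' i k) ->
  lowest e m n = lowest e' m n.
Proof.
move=> ee'; rewrite /lowest; congr take.
have /all_sigP[s ->] : all [pred i | (i < n)%N] (iota 0 n).
  by apply/allP => i; rewrite mem_iota.
rewrite !sort_map; congr (map _ (sort _ s)).
by apply/funext => -[i iN]; apply/funext => -[k kN]; exact: ee'.
Qed.

Lemma mem_lowest (e : rel nat) (m n i : nat) : i \in lowest e m n -> (i < n)%N.
Proof. by move=> /mem_take; rewrite mem_sort mem_iota. Qed.

Section finite_valued.
Context {R : realType} {d : measure_display} {T : measurableType d} {F : finType}.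
Variables (P : probability T R) (D : T -> F).
Hypothesis mD : forall f, measurable [set w | D w = f].

Lemma preimage_finite (A : pred F) :
  [set w | A (D w)] = \bigcup_(f in [set` A]) [set w | D w = f].
Proof.
apply/seteqP; split => w /=; first by move=> ADw; exists (D w).
by move=> [f Af ->].
Qed.

Lemma measurable_preimage_finite (A : pred F) : measurable [set w | A (D w)].
Proof.
by rewrite preimage_finite; apply: fin_bigcup_measurable => //; exact: finite_finset.
Qed.

Lemma prob_preimage_finite (A : pred F) :
  P [set w | A (D w)] = (\sum_(f | A f) P [set w | D w = f])%E.
Proof.
rewrite preimage_finite measure_fin_bigcup//.
  by rewrite -(bigfs _ (index_enum_uniq F))// => f _; rewrite mem_index_enum.
by move=> f g _ _ [w [/= <- <-]].
Qed.

End finite_valued.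

Lemma sum_lt_ord (n u : nat) : (u <= n)%N -> (\sum_(k < n) (k < u))%N = u.
Proof.
move=> un; rewrite -(big_mkord xpredT (fun k => (k < u) : nat)) (@big_cat_nat _ _ _ u)//=.
rewrite [X in (_ + X)%N]big_nat_cond [X in (_ + X)%N]big1 ?addn0; last first.
  by move=> k /andP[/andP[uk _] _]; rewrite ltnNge uk.
rewrite big_nat_cond (eq_bigr (fun=> 1%N)) => [|k /andP[/andP[_ ->] _]]//.
by rewrite -big_nat_cond sum_nat_const_nat muln1 subn0.
Qed.

Lemma measurable_eq_bool d (T : measurableType d) (f : T -> bool) (b : bool) :
  measurable_fun setT f -> measurable [set w | f w = b].
Proof.
by move=> mf; rewrite -[X in measurable X]setTI; exact: (mf measurableT [set b]).
Qed.

Section comparison.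
Context {R : realType} {d : measure_display} {T : measurableType d}.
Variables (P : probability T R) (Z X : nat -> T -> R).
Hypotheses (mZ : forall i, measurable_fun setT (Z i))
  (mX : forall i, measurable_fun setT (X i)) (ind : indep_pairs P Z X).
Variables (N' M' : nat) (q : R) (z J : nat -> R).
Notation N := N'.+1.
Notation M := M'.+1.
Hypothesis z_mono : forall u v, (0 < u)%N -> (u <= v <= N')%N -> z u <= z v.

(** The cut points [z 1 <= ... <= z N'] make [N] cells []z v, z v.+1]], the first unbounded below
    and the last unbounded above. *)
Definition cell (x : R) : nat := (\sum_(k < N') (z k.+1 < x)%R)%N.

Lemma cell_ltN x : (cell x < N)%N.
Proof.
rewrite ltnS /cell -[X in (_ <= X)%N](sum_lt_ord (leqnn N')).
by apply: leq_sum => k _; rewrite ltn_ord leq_b1.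
Qed.

Lemma cell_lt x v : (0 < v <= N')%N -> (cell x < v)%N = (x <= z v).
Proof.
move=> /andP[v0 vN]; apply/idP/idP => [|xv].
  apply: contraTT; rewrite -ltNge -leqNgt => vx.
  rewrite -[X in (X <= _)%N](sum_lt_ord vN); apply: leq_sum => k _.
  case: ltnP => // kv; suff -> : z k.+1 < x by [].
  by apply: le_lt_trans vx; apply: z_mono => //; rewrite kv.
rewrite -(prednK v0) ltnS.
rewrite -[X in (_ <= X)%N](@sum_lt_ord N' v.-1) ?(leq_trans (leq_pred _))//.
apply: leq_sum => k _; case: (ltnP k v.-1) => [|vk]; first by rewrite leq_b1.
rewrite ltNge (le_trans xv)//; apply: z_mono => //.
by rewrite ltn_ord andbT -(prednK v0) ltnS.
Qed.

Lemma cell_mono x y : x <= y -> (cell x <= cell y)%N.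
Proof.
move=> xy; apply: leq_sum => k _; case: (ltP (z k.+1) x) => // zx.
by rewrite (lt_le_trans zx xy).
Qed.

Definition level (i v : nat) : set T := [set w | (cell (Z i w) < v)%N].

Definition atom (i v : nat) (s : bool) : set T :=
  [set w | cell (Z i w) = v /\ (X i w <= q) = s].

(** A quadrant constrains both coordinates, so a condition on [Z] alone is written as a countable
    union over bounds [k] on [X]; [mark_sigma] exchanges the roles. *)
Lemma level_sigma i v : (v <= N)%N -> <<s quadrants (Z i) (X i) >> (level i v).
Proof.
set G := quadrants (Z i) (X i); move=> vN.
have [G0 GC GU] := smallest_sigma_algebra setT G.
case: v vN => [_|v]; first by rewrite (_ : level i 0 = set0)//; apply/seteqP; split.
rewrite ltnS leq_eqVlt => /predU1P[->|vN].
  rewrite (_ : level i N = setT).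
    by have := GC _ G0; rewrite setD0.
  by apply/seteqP; split => [//|w _]; exact: cell_ltN.
rewrite (_ : level i v.+1 = \bigcup_k [set w | Z i w <= z v.+1 /\ X i w <= k%:R]).
  apply: GU => k; apply: sub_sigma_algebra.
  by exists (z v.+1), k%:R.
apply/seteqP; split => w; rewrite /level /= cell_lt//; last by move=> [k _ []].
move=> Zw; exists (Num.bound `|X i w|) => //; split=> //.
by rewrite (le_trans (ler_norm _))// ltW// archi_boundP.
Qed.

Lemma mark_sigma i : <<s quadrants (Z i) (X i) >> [set w | X i w <= q].
Proof.
have [G0 GC GU] := smallest_sigma_algebra setT (quadrants (Z i) (X i)).
rewrite (_ : [set w | _] = \bigcup_k [set w | Z i w <= k%:R /\ X i w <= q]).
  apply: GU => k; apply: sub_sigma_algebra.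
  by exists k%:R, q.
apply/seteqP; split => w /=; last by move=> [k _ []].
move=> Xw; exists (Num.bound `|Z i w|) => //; split=> //.
by rewrite (le_trans (ler_norm _))// ltW// archi_boundP.
Qed.

Lemma atomE i v s : atom i v s =
  (level i v.+1 `\` level i v) `&`
  (if s then [set w | X i w <= q] else ~` [set w | X i w <= q]).
Proof.
rewrite /atom /level; apply/seteqP; split => w /=.
  move=> [<- Xs]; split; first by split; [exact: ltnSn|rewrite ltnn].
  by case: s Xs => //= Xs; rewrite /setC /= Xs.
move=> [[h1 /negP h2] hs]; split.
  by apply/eqP; rewrite eqn_leq -ltnS h1 leqNgt.
by case: s hs => //= /negP/negbTE.
Qed.

Lemma atom_sigma i v s : (v < N)%N -> <<s quadrants (Z i) (X i) >> (atom i v s).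
Proof.
move=> vN; rewrite atomE.
have m1 := @level_sigma i _ vN; have m2 := @level_sigma i _ (ltnW vN).
have m3 := @mark_sigma i.
pose U := g_sigma_algebraType (quadrants (Z i) (X i)).
apply: (@measurableI _ U); first exact: (@measurableD _ U).
by case: s; [|apply: (@measurableC _ U)].
Qed.

Lemma measurable_atom i v s : (v < N)%N -> measurable (atom i v s).
Proof. by move=> vN; exact: (quadrants_measurable (mZ i) (mX i) (@atom_sigma i v s vN)). Qed.

Hypothesis hL : forall i v, (v <= N)%N -> P (level i v) = (v%:R / N%:R)%:E.
Hypothesis hJ : forall i v, (v <= N)%N ->
  P (level i v `&` [set w | X i w <= q]) = (J v)%:E.

(** By [hJ], the increment of [J] is the probability of cell [v] together with [X <= q]; what
    remains of the cell mass is the weight [w0 v] of the finite model. *)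
Definition cell_miss (v : nat) : R := N%:R^-1 - (J v.+1 - J v).

Lemma prob_atom i v s : (v < N)%N ->
  P (atom i v s) = (mark_weight N' cell_miss v s)%:E.
Proof.
move=> vN.
have mLe u : (u <= N)%N -> measurable (level i u).
  by move=> uN; apply: (quadrants_measurable (mZ i) (mX i)); exact: level_sigma.
have mL1 := mLe _ vN; have mL := mLe _ (ltnW vN).
have mq : measurable [set w | X i w <= q] by exact: measurable_le.
have LL : level i v `<=` level i v.+1 by move=> w; rewrite /level /= => /ltnW.
have hit : P (atom i v true) = (J v.+1 - J v)%:E.
  rewrite atomE (_ : _ `&` _ = (level i v.+1 `&` [set w | X i w <= q]) `\`
      (level i v `&` [set w | X i w <= q])).
    rewrite measureD; [|exact: measurableI|exact: measurableI|]; last first.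
      by rewrite ltey_eq fin_prob//; exact: measurableI.
    rewrite (_ : _ `&` _ `&` _ = level i v `&` [set w | X i w <= q]).
      by rewrite [X in (X - _)%E]hJ// [X in (_ - X)%E]hJ// ltnW.
    by apply/seteqP; split => w /=; [case|move=> [/[dup]/LL]].
  apply/seteqP; split => w /=; first by move=> [[? ?] ?]; split => // -[].
  by move=> [[? ?] h]; split => //; split => // ?; exact: h.
case: s => [|]; first by rewrite hit /mark_weight /cell_miss subKr.
have -> : atom i v false = (level i v.+1 `\` level i v) `\` atom i v true.
  rewrite !atomE; apply/seteqP; split => w /=; first by move=> [? ?]; split => // -[].
  by move=> [? h]; split => // ?; exact: h.
have mD : measurable (level i v.+1 `\` level i v) by exact: measurableD.
have mA : measurable (atom i v true) by rewrite atomE; exact: measurableI.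
rewrite measureD//; last by rewrite ltey_eq fin_prob.
rewrite (_ : _ `&` atom i v true = atom i v true); last first.
  by rewrite atomE; apply/seteqP; split => w /=; [case|move=> []].
rewrite [X in (_ - X)%E]hit measureD//; last by rewrite ltey_eq fin_prob.
rewrite (_ : _ `&` level i v = level i v); last first.
  by apply/seteqP; split => w /=; [case|move=> /[dup]/LL].
rewrite [X in (X - _ - _)%E]hL// [X in (_ - X - _)%E]hL ?(ltnW vN)//.
rewrite /mark_weight /cell_miss -!EFinB; congr (_%:E).
by rewrite -mulrBl -natrB// subSnn mul1r.
Qed.

(** The weights of both marks are probabilities of atoms, and their nonnegativity gives the two
    bounds. *)
Lemma cell_miss_bound v : (v < N)%N -> 0 <= cell_miss v <= N%:R^-1.
Proof.
move=> vN.
have h s : 0 <= mark_weight N' cell_miss v s.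
  by rewrite -lee_fin -(prob_atom 0 s vN).
apply/andP; split; first exact: (h false).
by rewrite -subr_ge0; exact: (h true).
Qed.

Definition config (w : T) : {ffun 'I_M -> 'I_N} * {ffun 'I_M -> bool} :=
  ([ffun i : 'I_M => inord (cell (Z i w))], [ffun i : 'I_M => X i w <= q]).

Lemma config_fiber c b : [set w | config w = (c, b)] =
  [set w | forall i, (i < M)%N -> atom i (c (inord i)) (b (inord i)) w].
Proof.
apply/seteqP; split => w /=.
  move=> [<- <-] i iM; rewrite /atom /= !ffunE !inordK//; exact: cell_ltN.
move=> h; congr pair; apply/ffunP => i; rewrite ffunE;
  have := h i (ltn_ord i); rewrite inord_val => -[h1 h2] //.
by rewrite h1 inord_val.
Qed.

Lemma prob_config c b :
  P [set w | config w = (c, b)] = (config_weight cell_miss c b)%:E.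
Proof.
rewrite config_fiber.
pose A i := if (i < M)%N then atom i (c (inord i)) (b (inord i)) else set0.
have hA i : <<s quadrants (Z i) (X i) >> (A i).
  rewrite /A; case: ifP => _; first exact: atom_sigma.
  by have [] := smallest_sigma_algebra setT (quadrants (Z i) (X i)).
have := indep_pairs_sigma mZ mX ind M hA.
rewrite (_ : [set w | forall i, (i < M)%N -> A i w] =
  [set w | forall i, (i < M)%N -> atom i (c (inord i)) (b (inord i)) w]); last first.
  by apply/seteqP; split => w /= h i iM; have := h i iM; rewrite /A iM.
move=> ->; rewrite /config_weight -prodEFin; apply: eq_bigr => i _.
by rewrite /A ltn_ord inord_val prob_atom.
Qed.

Lemma measurable_config f : measurable [set w | config w = f].
Proof.
case: f => c b; rewrite config_fiber.
rewrite (_ : [set w | _] =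
  \bigcap_(i in [set i | (i < M)%N]) atom i (c (inord i)) (b (inord i))).
  by apply: bigcap_measurableType => i _; exact: measurable_atom.
by apply/seteqP; split.
Qed.

Definition miss_event (m n : nat) : set T :=
  [set w | forall j, j \in take m (Zorder (fun i => Z i w) n) -> q < X j w].

(** The miss event depends only on these finitely many comparisons, which yields its
    measurability. *)
Definition order_pattern (w : T) : {ffun 'I_M * 'I_M -> bool} * {ffun 'I_M -> bool} :=
  ([ffun ik : 'I_M * 'I_M => Z ik.1 w <= Z ik.2 w], [ffun i : 'I_M => X i w <= q]).

Lemma measurable_order_pattern f : measurable [set w | order_pattern w = f].
Proof.
case: f => e b.
rewrite (_ : [set w | _] =
  (\bigcap_(ik in [set: 'I_M * 'I_M]) [set w | (Z ik.1 w <= Z ik.2 w) = e ik]) `&`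
  (\bigcap_(i in [set: 'I_M]) [set w | (X i w <= q) = b i])).
  apply: measurableI; apply: fin_bigcap_measurable => //; try exact: finite_finset.
    by move=> [i k] _; exact: measurable_eq_bool (measurable_realfun.measurable_fun_ler (mZ i) (mZ k)).
  move=> i _; apply: (measurable_eq_bool (b i)).
  by apply: measurable_realfun.measurable_fun_ler => //; exact: measurable_cst.
apply/seteqP; split => w /=.
  by move=> [<- <-]; split => /= ? _; rewrite ffunE.
by move=> [h1 h2]; congr pair; apply/ffunP => ?; rewrite ffunE ?h1 ?h2.
Qed.

Lemma measurable_miss_event m n : (n <= M)%N -> measurable (miss_event m n).
Proof.
move=> nM.
pose A (f : {ffun 'I_M * 'I_M -> bool} * {ffun 'I_M -> bool}) : bool :=
  [forall i : 'I_M, ((i : nat) \in lowest (fun i k => f.1 (inord i, inord k)) m n) ==> ~~ f.2 i].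
rewrite (_ : miss_event m n = [set w | A (order_pattern w)]).
  exact/measurable_preimage_finite/measurable_order_pattern.
have lowE w : take m (Zorder (fun i => Z i w) n) =
    lowest (fun i k => (order_pattern w).1 (inord i, inord k)) m n.
  apply: eq_lowest => i k iN kN.
  by rewrite ffunE/= !inordK// (leq_trans _ nM).
apply/seteqP; split => w; rewrite /miss_event /A /= -lowE => h.
  by apply/forallP => i; apply/implyP => /h; rewrite ffunE -ltNge.
move=> j jl; have jM : (j < M)%N by rewrite (leq_trans _ nM)//; exact: mem_lowest jl.
by have /forallP/(_ (Ordinal jM)) := h; rewrite /= jl /= ffunE -ltNge.
Qed.

(** Outside the event [E] that two points share a cell, the true event and the cell event [B]
    coincide; [E] is controlled by [noninjective_le]. *)
Lemma miss_event_approx m n : (n <= M)%N ->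
  `|fine (P (miss_event m n)) - bad_prob N' M' cell_miss m n| <= M%:R * M%:R / N%:R.
Proof.
move=> nM.
pose B := [set w | (fun f => bad m n f.1 f.2) (config w)].
pose E := [set w | (fun f : {ffun 'I_M -> 'I_N} * {ffun 'I_M -> bool} => ~~ injectiveb f.1) (config w)].
have mB : measurable B by exact/measurable_preimage_finite/measurable_config.
have mE : measurable E by exact/measurable_preimage_finite/measurable_config.
have mV := measurable_miss_event m nM.
have sumE (A : pred ({ffun 'I_M -> 'I_N} * {ffun 'I_M -> bool})) :
    P [set w | A (config w)] =
    (\sum_c \sum_b config_weight cell_miss c b * (A (c, b))%:R)%:E.
  rewrite (prob_preimage_finite P measurable_config) pair_big /= -sumEFin.
  rewrite big_mkcond; apply: eq_bigr => -[c b] _ /=; rewrite prob_config.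
  by case: (A _); rewrite ?mulr1 ?mulr0.
have PB : P B = (bad_prob N' M' cell_miss m n)%:E by exact: sumE.
have PE : (P E <= (M%:R * M%:R / N%:R)%:E)%E.
  rewrite sumE lee_fin (le_trans _ (noninjective_le R N' M'))//.
  apply: ler_sum => c _ /=; rewrite -mulr_suml; apply: ler_wpM2r => //.
  (* Summing out the marks leaves [p ^ M] for each cell configuration: this is the case without
     forced points. *)
  have := config_weight_sum cell_miss c pred0; rewrite /=.
  under eq_bigr do rewrite (introT forallP) ?mulr1//.
  by move=> ->; rewrite prodr_const card_ord.
(* With distinct cells, comparing cells is comparing the [Z]-values, so both sorts return the same
   list. *)
have inj w : ~ E w -> miss_event m n w <-> B w.
  move=> /negP/negPn/injectiveP /= cinj.
  have lowE : take m (Zorder (fun i => Z i w) n) = lowest (cellrel (config w).1) m n.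
    apply: eq_lowest => i k iN kN.
    have iM := leq_trans iN nM; have kM := leq_trans kN nM.
    rewrite /cellrel /= !ffunE !inordK ?cell_ltN//.
    apply/idP/idP => [|cik]; first exact: cell_mono.
    rewrite leNgt; apply/negP => ki.
    have cki := cell_mono (ltW ki).
    have cE : cell (Z i w) = cell (Z k w) by apply/eqP; rewrite eqn_leq cik cki.
    have := cinj (inord i) (inord k); rewrite !ffunE !inordK// cE.
    move=> /(_ erefl)/(congr1 val) /=; rewrite !inordK// => ik.
    by rewrite ik ltxx in ki.
  rewrite /miss_event /B /bad /= -lowE; split => h.
    by apply/forallP => i; apply/implyP => /h; rewrite ffunE -ltNge.
  move=> j jl; have jM : (j < M)%N by rewrite (leq_trans _ nM)//; exact: mem_lowest jl.
  by have /forallP/(_ (Ordinal jM)) := h; rewrite /= jl /= ffunE -ltNge.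
have le_prob (A A' : set T) : measurable A -> measurable A' -> A `<=` A' `|` E ->
    fine (P A) <= fine (P A') + M%:R * M%:R / N%:R.
  move=> mA mA' AA'; rewrite -lee_fin EFinD !fineK ?fin_prob//.
  apply: (@le_trans _ _ (P (A' `|` E))).
    by apply: le_measure => //; rewrite inE//; exact: measurableU.
  by apply: (le_trans (measureU2 _ mA' mE)); rewrite leeD2l.
have -> : bad_prob N' M' cell_miss m n = fine (P B) by rewrite PB.
rewrite ler_distlC; apply/andP; split.
  rewrite lerBlDr; apply: le_prob => // w Bw.
  by have [Ew|nEw] := pselect (E w); [right|left; apply/inj].
apply: le_prob => // w Vw.
by have [Ew|nEw] := pselect (E w); [right|left; apply/inj].
Qed.

End comparison.

(** * The standard normal distribution *)

Section monotone_limits.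
Context {R : realType} {d : measure_display} {T : measurableType d}.
Variable P : probability T R.

Lemma prob_bigcup_le (F : nat -> set T) (u : \bar R) :
  (forall n, measurable (F n)) -> nondecreasing_seq F ->
  (forall n, P (F n) <= u)%E -> (P (\bigcup_n F n) <= u)%E.
Proof.
move=> mF ndF Fu.
have h : P \o F @ \oo --> P (\bigcup_n F n).
  by apply: nondecreasing_cvg_mu => //; exact: bigcup_measurable.
rewrite -(cvg_lim _ h)//; apply: lime_le; first by apply/cvg_ex; exists (P (\bigcup_n F n)).
by apply: nearW => n; exact: Fu.
Qed.

Lemma prob_bigcap_ge (F : nat -> set T) (u : \bar R) :
  (forall n, measurable (F n)) -> nonincreasing_seq F ->
  (forall n, u <= P (F n))%E -> (u <= P (\bigcap_n F n))%E.
Proof.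
move=> mF niF Fu.
have h : P \o F @ \oo --> P (\bigcap_n F n).
  apply: nonincreasing_cvg_mu => //; first by rewrite ltey_eq fin_prob.
  exact: bigcap_measurableType.
rewrite -(cvg_lim _ h)//; apply: lime_ge; first by apply/cvg_ex; exists (P (\bigcap_n F n)).
by apply: nearW => n; exact: Fu.
Qed.

Variable f : T -> R.
Hypothesis mf : measurable_fun setT f.

(** Here and in the next three lemmas, continuity of [P] along half-lines is put as a one-sided
    bound, ready to be fed with the inequalities defining a generalised inverse. *)
Lemma prob_le_nat_ub (u : \bar R) :
  (forall k : nat, P [set w | f w <= k%:R]%R <= u)%E -> (1 <= u)%E.
Proof.
move=> h; rewrite -(probability_setT P).
rewrite (_ : setT = \bigcup_k [set w | f w <= k%:R]).
  apply: prob_bigcup_le => // [n|m n mn]; first exact: measurable_le.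
  by apply/subsetPset => w /= /le_trans; apply; rewrite ler_nat.
apply/seteqP; split => // w _; exists (Num.bound `|f w|) => //=.
by rewrite (le_trans (ler_norm _))// ltW// archi_boundP.
Qed.

Lemma prob_le_nat_lb (u : \bar R) :
  (forall k : nat, u <= P [set w | f w <= - k%:R]%R)%E -> (u <= 0)%E.
Proof.
move=> h; rewrite -(measure0 P).
rewrite (_ : set0 = \bigcap_k [set w | f w <= - k%:R]).
  apply: prob_bigcap_ge => // [n|m n mn]; first exact: measurable_le.
  by apply/subsetPset => w /= /le_trans; apply; rewrite lerN2 ler_nat.
apply/seteqP; split => // w /= h'; have := h' (Num.bound `|f w|) I => /= fw.
have := archi_boundP (normr_ge0 (f w)); rewrite ltNge => /negP; apply.
by rewrite lerNr in fw; rewrite (le_trans fw)// -normrN ler_norm.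
Qed.

Lemma prob_le_right (a : R) (u : \bar R) :
  (forall t : R, a < t -> (u <= P [set w | (f w <= t)%R])%E) -> (u <= P [set w | (f w <= a)%R])%E.
Proof.
move=> h; rewrite (_ : [set w | _] = \bigcap_n [set w | f w <= a + n.+1%:R^-1]).
  apply: prob_bigcap_ge => // [n|m n mn|n].
  - exact: measurable_le.
  - apply/subsetPset => w /= /le_trans; apply.
    by rewrite lerD2l lef_pV2 ?posrE// ler_nat ltnS.
  - by apply: h; rewrite ltrDl invr_gt0.
apply/seteqP; split => w /= fw.
  by move=> n _ /=; rewrite (le_trans fw)// lerDl.
apply/ler_addgt0Pr => e e0.
have [n ne] : exists n : nat, n.+1%:R^-1 < e.
  exists (Num.bound e^-1); rewrite invf_plt ?posrE//.
  by rewrite (lt_trans (archi_boundP _)) ?ltr_nat// invr_ge0 ltW.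
by have := fw n I => /= /le_trans; apply; rewrite lerD2l ltW.
Qed.

Lemma prob_lt_left (a : R) (u : \bar R) :
  (forall t : R, t < a -> (P [set w | (f w <= t)%R] <= u)%E) -> (P [set w | (f w < a)%R] <= u)%E.
Proof.
move=> h; rewrite (_ : [set w | _] = \bigcup_n [set w | f w <= a - n.+1%:R^-1]).
  apply: prob_bigcup_le => // [n|m n mn|n].
  - exact: measurable_le.
  - apply/subsetPset => w /= /le_trans; apply.
    by rewrite lerD2l lerN2 lef_pV2 ?posrE// ler_nat ltnS.
  - by apply: h; rewrite ltrBlDr ltrDl invr_gt0.
apply/seteqP; split => w /= fw; last first.
  by case: fw => n _ /= /le_lt_trans; apply; rewrite ltrBlDr ltrDl invr_gt0.
have e0 : 0 < a - f w by rewrite subr_gt0.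
exists (Num.bound (a - f w)^-1) => //=.
rewrite lerBrDl addrC -lerBrDl ltW// invf_plt ?posrE//.
by rewrite (lt_trans (archi_boundP _)) ?ltr_nat// invr_ge0 ltW.
Qed.

End monotone_limits.

(* [normal_prob] is a measure for [measurableTypeR R], whereas the product in [Phi2] is formed
   over [R] with its default measurable structure: same measurable sets, another display. *)
Section default_display.
Context {R : realType}.

Let nu : probability (measurableTypeR R) R := normal_prob 0 1.

Definition normal01 : set R -> \bar R := @stdN R.

Let normal01_0 : normal01 set0 = 0%E. Proof. exact: (measure0 nu). Qed.
Let normal01_ge0 A : (0 <= normal01 A)%E. Proof. exact: (measure_ge0 nu). Qed.
Let normal01_sigma_additive : semi_sigma_additive normal01.
Proof. exact: (@measure_semi_sigma_additive _ _ _ nu). Qed.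

HB.instance Definition _ := isMeasure.Build default_measure_display R R
  normal01 normal01_0 normal01_ge0 normal01_sigma_additive.

Let normal01_setT : normal01 setT = 1%E. Proof. exact: (probability_setT nu). Qed.

HB.instance Definition _ := Measure_isProbability.Build _ _ R normal01 normal01_setT.

End default_display.

Section gaussian.
Context {R : realType}.

Let nu : probability R R := normal01.

Lemma measurable_id_R : measurable_fun (setT : set R) (fun x : R => x).
Proof. exact: measurable_id. Qed.

Lemma normal_prob_set1 (a : R) : nu [set a] = 0%E.
Proof.
have := @normal_prob_dominates R 0 1 => /null_content_dominatesP; apply => //.
exact: lebesgue_measure_set1.
Qed.

Lemma Phi_mono (s t : R) : s <= t -> (Phi s <= Phi t)%E.
Proof.
move=> st; apply: (@le_measure _ _ _ nu); rewrite ?inE; try exact: measurable_le measurable_id_R.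
by move=> x /= /le_trans; exact.
Qed.

(** On the compact interval [[a - 1, a]] the continuous positive density has a positive minimum. *)
Lemma Phi_gt0 (a : R) : (0 < Phi a)%E.
Proof.
have ab : a - 1 <= a by rewrite lerBlDr lerDl.
have [|c _ hc] := @EVT_min R (normal_pdf 0 1) (a - 1) a ab.
  by apply: continuous_subspaceT; apply: continuous_normal_pdf; rewrite oner_eq0.
have c0 : 0 < normal_pdf 0 1 c.
  by rewrite normal_pdfE ?oner_eq0// mulr_gt0 ?expR_gt0 ?normal_peak_gt0 ?oner_eq0.
apply: (@lt_le_trans _ _ (nu `[a - 1, a]%classic)); last first.
  apply: (@le_measure _ _ _ nu); rewrite ?inE //=; first exact: measurable_le measurable_id_R.
  by move=> x /=; rewrite in_itv /= => /andP[].
apply: (@lt_le_trans _ _ (\int[lebesgue_measure]_(x in `[(a - 1)%R, a]) (cst (normal_pdf 0 1 c)%:E x))%E).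
  rewrite integral_cst// [X in (_ * X)%E](lebesgue_measure_itv `[a - 1, a]) /= lte_fin ltrBlDr ltrDl ltr01.
  by rewrite -EFinB -EFinM lte_fin mulr_gt0// subKr.
apply: ge0_le_integral => //; first by move=> x _; rewrite lee_fin ltW.
by apply/measurable_realfun.measurable_EFinP/measurable_funTS; exact: measurable_normal_pdf.
Qed.

Lemma Phi_inv_mono (u v : R) : u <= v -> (Phi_inv u <= Phi_inv v)%E.
Proof.
move=> uv; apply: ereal_inf_le_tmp => _ [t /= vt <-]; exists t => //.
by apply: le_trans vt; rewrite lee_fin.
Qed.

Lemma Phi_inv_le (u a : R) : (u%:E <= Phi a)%E -> (Phi_inv u <= a%:E)%E.
Proof. by move=> ua; apply: ereal_inf_lbound; exists a. Qed.

Lemma Phi_ge_of_Phi_inv_lt (u t : R) : (Phi_inv u < t%:E)%E -> (u%:E <= Phi t)%E.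
Proof.
move=> /ereal_inf_lt[_ [s us <-]]; rewrite lte_fin => st.
by apply: (le_trans us); apply: Phi_mono; exact: ltW.
Qed.

Lemma Phi_inv_gtNy (u : R) : 0 < u -> (-oo < Phi_inv u)%E.
Proof.
move=> u0; rewrite ltNye; apply/eqP => h.
have : (u%:E <= 0)%E.
  apply: (@prob_le_nat_lb _ _ _ nu _ measurable_id_R) => k.
  by apply: Phi_ge_of_Phi_inv_lt; rewrite h ltNyr.
by rewrite lee_fin leNgt u0.
Qed.

Lemma Phi_inv_lty (u : R) : u < 1 -> (Phi_inv u < +oo)%E.
Proof.
move=> u1; rewrite ltey; apply/eqP => h.
have : (1 <= u%:E)%E.
  apply: (@prob_le_nat_ub _ _ _ nu _ measurable_id_R) => k.
  rewrite leNgt; apply/negP => /ltW/Phi_inv_le; rewrite h.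
  by rewrite leye_eq.
by rewrite lee_fin leNgt u1.
Qed.

(** At a real value of [Phi_inv u], right continuity gives one inequality, and the left limit with
    the absence of atoms the other. The values [+oo] and [-oo] force [u = 1] and [u = 0]. *)
Lemma normal_prob_le_Phi_inv (u : R) : 0 <= u <= 1 ->
  nu [set t : R | (t%:E <= Phi_inv u)%E] = u%:E.
Proof.
move=> /andP[u0 u1]; case E: (Phi_inv u) => [a| |].
- apply/eqP; rewrite eq_le; apply/andP; split; last first.
    apply: (@prob_le_right _ _ _ nu _ measurable_id_R) => t at_.
    by apply: Phi_ge_of_Phi_inv_lt; rewrite E lte_fin.
  apply: (@le_trans _ _ (nu [set t : R | t < a])).
    rewrite (_ : [set t : R | (t%:E <= a%:E)%E] = [set t : R | t < a] `|` [set a]).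
      apply: (le_trans (measureU2 _ _ _)) => //.
        by rewrite -set_itvNyo.
      by rewrite [X in (_ + X)%E]normal_prob_set1 adde0.
    apply/seteqP; split => t /=; rewrite lee_fin.
      by rewrite le_eqVlt => /predU1P[->|?]; [right|left].
    by move=> [/ltW//|->].
  apply: (@prob_lt_left _ _ _ nu _ measurable_id_R) => t ta.
  rewrite leNgt; apply/negP => /ltW/Phi_inv_le; rewrite E lee_fin leNgt ta.
  by [].
- rewrite (_ : [set t : R | _] = setT); last first.
    by apply/seteqP; split => // t _ /=; rewrite leey.
  rewrite probability_setT; congr (_%:E); apply/eqP; rewrite eq_le u1 andbT.
  by rewrite leNgt; apply/negP => /Phi_inv_lty; rewrite E ltxx.
- rewrite (_ : [set t : R | _] = set0); last first.
    by apply/seteqP; split => // t /=; rewrite leeNy_eq.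
  rewrite measure0; congr (_%:E); apply/eqP; rewrite eq_le u0 /=.
  by rewrite leNgt; apply/negP => /Phi_inv_gtNy; rewrite E ltxx.
Qed.

End gaussian.

(** * Concavity of the conditional distribution *)

Section halfplane.
Context {R : realType}.
Variables (nu : probability R R) (rho : R) (b : \bar R).
Hypothesis rho01 : 0 < rho <= 1.

Let s := Num.sqrt (1 - rho ^+ 2).

Let s0 : 0 <= s. Proof. exact: sqrtr_ge0. Qed.
Let s1 : s <= 1.
Proof.
by rewrite /s -[leRHS]sqrtr1; apply: ler_wsqrtr; rewrite lerBlDr lerDl sqr_ge0.
Qed.

Definition strip (L : set R) :
    set (R * R) :=
  [set p | L p.1 /\ ((rho * p.1 + s * p.2)%:E <= b)%E].

Definition slice (a : R) : set R :=
  [set v : R | ((rho * a + s * v)%:E <= b)%E].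

(** Conditional probability of the half-plane given that the first coordinate equals [a]. *)
Definition hit_rate (a : R) : R := fine (nu (slice a)).

Lemma measurable_le_ereal d (T : measurableType d) (f : T -> R) :
  measurable_fun setT f -> measurable [set w | ((f w)%:E <= b)%E].
Proof.
move=> mf; case: b => [b'| |].
- exact: measurable_le.
- by rewrite (_ : [set w | _] = setT)//; apply/seteqP; split => // w _ /=; rewrite leey.
- by rewrite (_ : [set w | _] = set0)//; apply/seteqP; split => // w /=; rewrite leeNy_eq.
Qed.

Lemma measurable_strip (L : set R) : measurable L -> measurable (strip L).
Proof.
move=> mL; rewrite (_ : strip L = (L `*` setT) `&`
    [set p | ((rho * p.1 + s * p.2)%:E <= b)%E]); last first.
  by apply/seteqP; split => p /=; [move=> [? ?]|move=> [[? _] ?]].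
apply: measurableI; first exact: measurableX.
apply: (@measurable_le_ereal _ (R * R)%type
  (fun p => rho * p.1 + s * p.2)).
apply: measurable_realfun.measurable_funD; apply: measurable_realfun.measurable_funM => //.
Qed.

Lemma measurable_slice (a : R) : measurable (slice a).
Proof.
apply: (@measurable_le_ereal _ R (fun v => rho * a + s * v)).
exact: measurable_realfun.measurable_funD.
Qed.

Lemma slice_prob (a : R) : nu (slice a) = (hit_rate a)%:E.
Proof. by rewrite fineK// fin_prob//; exact: measurable_slice. Qed.

Let rho0 : 0 < rho. Proof. by case/andP: rho01. Qed.

(* On [L] the fibre of the half-plane over [x <= a] contains the one over [a], as [rho > 0]. *)
Lemma strip_ge (L : set R) (a : R) :
  measurable L -> (forall x, L x -> x <= a) ->
  (nu L * (hit_rate a)%:E <= (nu \x nu) (strip L))%E.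
Proof.
move=> mL La; rewrite -slice_prob -(product_measure1E nu nu mL (measurable_slice a)).
apply: le_measure; rewrite ?inE.
- by apply: measurableX => //; exact: measurable_slice.
- exact: measurable_strip.
move=> [x v] [/= Lx]; rewrite /slice /strip /= => h; split => //.
by apply: le_trans h; rewrite lee_fin lerD2r ler_pM2l// La.
Qed.

Lemma strip_le (L : set R) (a : R) :
  measurable L -> (forall x, L x -> a <= x) ->
  ((nu \x nu) (strip L) <= nu L * (hit_rate a)%:E)%E.
Proof.
move=> mL La; rewrite -slice_prob -(product_measure1E nu nu mL (measurable_slice a)).
apply: le_measure; rewrite ?inE.
- exact: measurable_strip.
- by apply: measurableX => //; exact: measurable_slice.
move=> [x v] [/= Lx h]; rewrite /slice /=; split => //=.
by apply: le_trans h; rewrite lee_fin lerD2r ler_pM2l// La.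
Qed.

Lemma strip_diff (L L' : set R) :
  measurable L -> measurable L' -> L `<=` L' ->
  ((nu \x nu) (strip L') = (nu \x nu) (strip (L' `\` L)) + (nu \x nu) (strip L))%E.
Proof.
move=> mL mL' LL'.
have <- : strip L' `\` strip L = strip (L' `\` L).
  apply/seteqP; split => p; rewrite /strip /=.
    by move=> [[? ?] h]; split => //; split => // ?; exact: h.
  by move=> [[? nL] ?]; split => // -[].
have {2}<- : strip L' `&` strip L = strip L.
  apply/seteqP; split => p; rewrite /strip /=; first by move=> [].
  by move=> [/[dup]/LL'].
exact: measureDI (measurable_strip mL') (measurable_strip mL).
Qed.

(** Take [k] with [nu] of [v <= k] at least [1 - eps] and a real [b'] below [b]. Since
    [0 <= s <= 1], [v <= k] gives [s * v <= k], so the slice over [a] contains this half-line once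
    [rho * a <= b' - k]. *)
Lemma hit_rate_near1 (eps : R) : (-oo < b)%E -> 0 < eps ->
  exists a0, forall a, a <= a0 -> 1 - eps <= hit_rate a.
Proof.
move=> b0 e0.
have [k hk] : exists k : nat, ((1 - eps)%R%:E <= nu [set v : R | (v <= k%:R)%R])%E.
  apply: contrapT => /forallNP h.
  have : (1 <= (1 - eps)%R%:E)%E.
    apply: (@prob_le_nat_ub _ _ _ nu _ measurable_id_R) => k.
    by rewrite leNgt; apply/negP => /ltW; exact: h.
  by rewrite lee_fin leNgt ltrBlDr ltrDl e0.
have [b' bb'] : exists b' : R, (b'%:E <= b)%E.
  by case: b b0 => [x _|_|]; [exists x|exists 0; rewrite leey|rewrite ltxx].
exists ((b' - k%:R) / rho) => a; rewrite ler_pdivlMr// => ha.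
rewrite -lee_fin -slice_prob; apply: (le_trans hk).
apply: le_measure; rewrite ?inE.
- exact: measurable_le measurable_id_R.
- exact: measurable_slice.
move=> v /= vk; apply: le_trans bb'; rewrite lee_fin.
have k0 : (0 : R) <= k%:R by [].
have : s * v <= k%:R.
  have [v0|v0] := leP 0 v; first by rewrite (le_trans _ vk)// ler_piMl.
  by apply: le_trans k0; rewrite mulr_ge0_le0// ltW.
by rewrite mulrC in ha; lra.
Qed.

End halfplane.

(** * Slopes of the joint distribution function *)

Section copula_slope.
Context {R : realType} {d : measure_display} {T : measurableType d}.
Variables (P : probability T R) (Z X : T -> R) (FZ FX : R -> R) (rho q : R).
Hypotheses (mZ : measurable_fun setT Z) (mX : measurable_fun setT X).
Hypotheses (rho01 : 0 < rho <= 1).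
Hypothesis PZ : forall z, P [set w | Z w <= z] = (FZ z)%:E.
Hypothesis PX : forall x, P [set w | X w <= x] = (FX x)%:E.
Hypothesis PZX : forall z x, P [set w | Z w <= z /\ X w <= x] =
                 Phi2 rho (Phi_inv (FZ z)) (Phi_inv (FX x)).

Let nu : probability R R := normal01.
Let b := Phi_inv (FX q).

Definition joint (e : R) : R := fine (P [set w | Z w <= e /\ X w <= q]).
(** The conditional probability of [X <= q] at the normal score of [z]. It is shown below to be a
    supergradient, at [FZ z], of [joint] as a function of [FZ]. *)
Definition slope (z : R) : R := hit_rate nu rho b (fine (Phi_inv (FZ z))).

Let lev (e : R) : set R := [set t : R | (t%:E <= Phi_inv (FZ e))%E].

Lemma cdf01 z : 0 <= FZ z <= 1.
Proof.
rewrite -!lee_fin -PZ measure_ge0 /=; apply: probability_le1; exact: measurable_le.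
Qed.

Lemma cdf_mono u v : u <= v -> FZ u <= FZ v.
Proof.
move=> uv; rewrite -lee_fin -!PZ; apply: le_measure; rewrite ?inE; try exact: measurable_le.
by move=> w /= /le_trans; exact.
Qed.

Let mlev e : measurable (lev e).
Proof. by apply: measurable_le_ereal; exact: measurable_id_R. Qed.

Let nu_lev e : nu (lev e) = (FZ e)%:E.
Proof. exact/normal_prob_le_Phi_inv/cdf01. Qed.

Let lev_sub u v : u <= v -> lev u `<=` lev v.
Proof. by move=> uv t /= /le_trans; apply; apply/Phi_inv_mono/cdf_mono. Qed.

Let nu_levD u v : u <= v -> nu (lev v `\` lev u) = (FZ v - FZ u)%:E.
Proof.
move=> uv; rewrite measureD//; last by rewrite ltey_eq fin_prob.
rewrite setIidr; last exact: lev_sub.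
by rewrite [X in (X - _)%E]nu_lev [X in (_ - X)%E]nu_lev.
Qed.

Let jointE e : ((nu \x nu) (strip rho b (lev e)))%E = (joint e)%:E.
Proof.
(* After [PZX] both sides are the same product measure, [Phi2] being by definition that of the
   half-plane over [lev e]. *)
rewrite fineK; first by rewrite PZX; reflexivity.
by rewrite fin_prob//; apply: measurableI; exact: measurable_le.
Qed.

Let jointD u v : u <= v ->
  ((nu \x nu) (strip rho b (lev v `\` lev u)))%E = (joint v - joint u)%:E.
Proof.
move=> uv; have := @strip_diff _ nu rho b _ _ (mlev u) (mlev v) (lev_sub uv).
rewrite !jointE EFinB => ->; rewrite addeK//.
Qed.

Section at_threshold.
Variable z : R.
Hypothesis z01 : 0 < FZ z < 1.

(** Strictly between the values 0 and 1 of [FZ] the score is real, so the [fine] in [slope] loses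
    nothing. *)
Let fin_z : ((fine (Phi_inv (FZ z)))%:E = Phi_inv (FZ z))%E.
Proof.
have /andP[z0 z1] := z01.
by apply: fineK; rewrite fin_numElt Phi_inv_gtNy// Phi_inv_lty.
Qed.

(** The scores in [lev e] but not in [lev z] lie above the score of [z], where the fibres are
    contained in the fibre over it. *)
Lemma joint_right e : z <= e -> joint e - joint z <= slope z * (FZ e - FZ z).
Proof.
move=> ze; rewrite -lee_fin -jointD// mulrC EFinM -nu_levD//.
apply: strip_le => //; first exact: measurableD.
by move=> t [_ /negP]; rewrite -fin_z lee_fin -ltNge => /ltW.
Qed.

Lemma joint_left e : e <= z -> slope z * (FZ z - FZ e) <= joint z - joint e.
Proof.
move=> ez; rewrite -lee_fin -jointD// mulrC EFinM -nu_levD//.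
apply: strip_ge => //; first exact: measurableD.
by move=> t [+ _]; rewrite /lev /= -fin_z lee_fin.
Qed.

Lemma joint_leftNy : slope z * FZ z <= joint z.
Proof.
rewrite -lee_fin -jointE mulrC EFinM -nu_lev.
apply: strip_ge => // t.
by rewrite /lev /= -fin_z lee_fin.
Qed.

Lemma slope_ge0 : 0 <= slope z.
Proof. exact: fine_ge0. Qed.

(** Limit of [joint_right] at [+oo], along the bounds [k] on [Z]. *)
Lemma joint_righty : FX q - joint z <= slope z * (1 - FZ z).
Proof.
rewrite lerBlDr -lee_fin -PX.
rewrite (_ : [set w | X w <= q] = \bigcup_k [set w | Z w <= k%:R /\ X w <= q]).
  apply: prob_bigcup_le => [k|m n mn|k].
  - by apply: measurableI; exact: measurable_le.
  - by apply/subsetPset => w /= [h ?]; split => //; rewrite (le_trans h)// ler_nat.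
  rewrite -[leLHS]fineK; last first.
    by rewrite fin_prob//; apply: measurableI; exact: measurable_le.
  rewrite lee_fin -[fine _]/(joint k%:R) -lerBlDr.
  have [zk|kz] := leP z k%:R.
    apply: (le_trans (joint_right zk)); apply: ler_wpM2l; first exact: slope_ge0.
    by rewrite lerD2r; case/andP: (cdf01 k%:R).
  (* For [k < z] the left side is nonpositive and the right side nonnegative. *)
  have := joint_left (ltW kz) => h.
  apply: (@le_trans _ _ 0); last first.
    by rewrite mulr_ge0 ?slope_ge0// subr_ge0; case/andP: z01 => _ /ltW.
  rewrite subr_le0 -subr_ge0; apply: le_trans h.
  by rewrite mulr_ge0 ?slope_ge0// subr_ge0 cdf_mono// ltW.
apply/seteqP; split => w /=; last by move=> [k _ []].
move=> Xw; exists (Num.bound `|Z w|) => //=; split => //.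
by rewrite (le_trans (ler_norm _))// ltW// archi_boundP.
Qed.

End at_threshold.

(** With [a0] from [hit_rate_near1], take [delta = Phi a0]: then [FZ z <= delta] puts the score of
    [z] below [a0]. *)
Lemma slope_near1 (eps : R) : 0 < FX q -> 0 < eps ->
  exists2 delta, 0 < delta & forall z, 0 < FZ z < 1 -> FZ z <= delta -> 1 - eps <= slope z.
Proof.
move=> q0 e0.
have [a0 ha0] := hit_rate_near1 nu rho01 (Phi_inv_gtNy q0) e0.
have fP : Phi a0 \is a fin_num.
  by rewrite (@fin_prob _ _ _ nu)//; exact: measurable_le measurable_id_R.
exists (fine (Phi a0)); first by rewrite -lte_fin fineK ?Phi_gt0.
move=> z z01 zd; have /andP[z0 z1] := z01; apply: ha0.
rewrite -lee_fin fineK; last by rewrite fin_numElt Phi_inv_gtNy// Phi_inv_lty.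
by apply: Phi_inv_le; rewrite -(fineK fP) lee_fin.
Qed.

End copula_slope.

(** * The copula model *)

Lemma exists_inv_nat_le (R : archiRealFieldType) (c e : R) (k : nat) : 0 < e ->
  exists2 N' : nat, (k <= N')%N & c / N'.+1%:R <= e.
Proof.
move=> e0; exists (maxn k (Num.bound (c / e))); first exact: leq_maxl.
rewrite ler_pdivrMr// mulrC -ler_pdivrMr//.
apply: (le_trans (ler_norm _)); rewrite ltW//.
have := archi_boundP (normr_ge0 (c / e)); rewrite /Num.bound normr_id => /lt_le_trans; apply.
by rewrite ler_nat leqW// leq_maxr.
Qed.

Section copula_model.
Context {R : realType} {d : measure_display} {T : measurableType d}.
Variables (P : probability T R) (Z X : nat -> T -> R) (FZ FX : R -> R) (rho : R).
Hypothesis model : gaussian_copula_iid P Z X FZ FX rho.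
Hypothesis rho01 : 0 < rho <= 1.

Let mZ i : measurable_fun setT (Z i). Proof. by case: model. Qed.
Let mX i : measurable_fun setT (X i). Proof. by case: model => _ []. Qed.
Let ind : indep_pairs P Z X. Proof. by case: model => _ [_ []]. Qed.
Let FZ_cont : continuous FZ. Proof. by case: model => _ [_ [_ []]]. Qed.
Let PZ i z : P [set w | Z i w <= z] = (FZ z)%:E.
Proof. by case: model => _ [_ [_ [_ [_ []]]]]. Qed.
Let PX i x : P [set w | X i w <= x] = (FX x)%:E.
Proof. by case: model => _ [_ [_ [_ [_ [_ []]]]]]. Qed.
Let PZX i z x : P [set w | Z i w <= z /\ X i w <= x] =
  Phi2 rho (Phi_inv (FZ z)) (Phi_inv (FX x)).
Proof. by case: model => _ [_ [_ [_ [_ [_ []]]]]]. Qed.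

(** Intermediate values of the continuous [FZ]; this provides cut points for cells of exactly equal
    probability. *)
Lemma FZ_onto (c : R) : 0 < c < 1 -> exists z, FZ z = c.
Proof.
move=> /andP[c0 c1].
have [k hk] : exists k : nat, c <= FZ k%:R.
  apply: contrapT => /forallNP h; have : (1 <= c%:E)%E.
    apply: (prob_le_nat_ub (P := P) (mZ 0)) => k.
    by rewrite PZ lee_fin leNgt; apply/negP => /ltW; exact: h.
  by rewrite lee_fin leNgt c1.
have [l hl] : exists l : nat, FZ (- l%:R) <= c.
  apply: contrapT => /forallNP h; have : (c%:E <= 0)%E.
    apply: (prob_le_nat_lb (P := P) (mZ 0)) => l.
    by rewrite PZ lee_fin leNgt; apply/negP => /ltW; exact: h.
  by rewrite lee_fin leNgt c0.
have lk : - l%:R <= k%:R :> R by rewrite (@le_trans _ _ 0)// oppr_le0.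
have [||z _ <-] := @IVT R FZ (- l%:R) k%:R c lk; last by exists z.
  exact: continuous_subspaceT.
by rewrite ge_min hl le_max hk orbT.
Qed.

Section fixed_level.
Variable q : R.

Let J0 (e : R) : R := joint P (Z 0) (X 0) q e.
Let sl : R -> R := slope FZ FX rho q.

(** Collects what the finite model needs from the copula: bounds and monotonicity of the weights,
    the approximation error, and small weights in the left tail. *)
Lemma discretisation (N' : nat) : exists w0 : nat -> R,
  [/\ forall v, (v < N'.+1)%N -> 0 <= w0 v <= N'.+1%:R^-1,
      forall u v, (u <= v < N'.+1)%N -> w0 u <= w0 v,
      forall M' m n, (n <= M'.+1)%N ->
        `|fine (P (miss_event Z X q m n)) - bad_prob N' M' w0 m n| <=
          M'.+1%:R * M'.+1%:R / N'.+1%:R &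
      forall eps delta, (forall z, 0 < FZ z < 1 -> FZ z <= delta -> 1 - eps <= sl z) ->
        forall v, (v < N')%N -> v.+1%:R / N'.+1%:R <= delta -> w0 v <= eps / N'.+1%:R].
Proof.
have N0 : 0 < N'.+1%:R :> R by [].
have thr v : exists z, (0 < v <= N')%N -> FZ z = v%:R / N'.+1%:R.
  case: (boolP (0 < v <= N')%N) => [/andP[v0 vN]|]; last by exists 0.
  have [|z <-] := @FZ_onto (v%:R / N'.+1%:R); last by exists z.
  by rewrite divr_gt0 ?ltr0n//= ltr_pdivrMr// mul1r ltr_nat ltnS.
have {thr}[z Fz] := choice thr.
have z01 v : (0 < v <= N')%N -> 0 < FZ (z v) < 1.
  move=> vN; rewrite Fz//; case/andP: vN => v0 vN.
  by rewrite divr_gt0 ?ltr0n//= ltr_pdivrMr// mul1r ltr_nat ltnS.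
have z_mono u v : (0 < u)%N -> (u <= v <= N')%N -> z u <= z v.
  move=> u0 /andP[uv vN]; rewrite leNgt; apply/negP => zvu.
  have := cdf_mono (mZ 0) (PZ 0) (ltW zvu).
  rewrite !Fz ?u0 ?(leq_trans uv)// ?(leq_trans u0)//.
  rewrite ler_pM2r ?invr_gt0// ler_nat => vu.
  by move: zvu; rewrite (_ : u = v) ?ltxx//; apply/eqP; rewrite eqn_leq uv.
have PJ i e : P [set w | Z i w <= e /\ X i w <= q] = (J0 e)%:E.
  rewrite PZX -(PZX 0) /J0 /joint fineK// fin_prob//.
  by apply: measurableI; exact: measurable_le.
(* Levels [0] and [N'.+1] are the empty and the full event, with no cut point attached; hence the
   values [0] and [FX q]. *)
pose J v : R := if v == 0%N then 0 else if (v <= N')%N then J0 (z v) else FX q.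
have levelE i v : (0 < v <= N')%N -> level Z N' z i v = [set w | Z i w <= z v].
  by move=> vN; apply/seteqP; split => w; rewrite /level /= (cell_lt z_mono).
have level0 i : level Z N' z i 0 = set0 by apply/seteqP; split.
have levelN i : level Z N' z i N'.+1 = setT.
  by apply/seteqP; split => // w _; exact: cell_ltN.
have hL i v : (v <= N'.+1)%N -> P (level Z N' z i v) = (v%:R / N'.+1%:R)%:E.
  case: v => [_|v]; first by rewrite level0 measure0 mul0r.
  rewrite ltnS leq_eqVlt => /predU1P[->|vN].
    by rewrite levelN probability_setT divff// gt_eqF.
  by rewrite levelE//= PZ Fz.
have hJ i v : (v <= N'.+1)%N -> P (level Z N' z i v `&` [set w | X i w <= q]) = (J v)%:E.
  rewrite /J; case: v => [_|v]; first by rewrite level0 set0I measure0.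
  rewrite ltnS leq_eqVlt => /predU1P[->|vN].
    by rewrite levelN setTI PX /= ltnn.
  by rewrite levelE//= vN; exact: PJ.
have jump v : (v.+1%:R - v%:R) / N'.+1%:R = N'.+1%:R^-1 :> R.
  by rewrite -natrB// subSnn mul1r.
(* By [low] and [high], the slope at the common cut point [z v.+1] separates the increments of [J]
   over cells [v] and [v.+1]; so the increments decrease and the misses increase. *)
have low v : (v < N')%N -> sl (z v.+1) / N'.+1%:R <= J v.+1 - J v.
  move=> vN; have zv := z01 v.+1 vN; rewrite /J /= vN.
  case: v vN zv => [|v] vN zv /=.
    have := joint_leftNy q (mZ 0) (mX 0) rho01 (PZ 0) (PZX 0) zv.
    by rewrite Fz// mul1r subr0.
  rewrite (ltnW vN).
  have zz : z v.+1 <= z v.+2 by apply: z_mono => //; rewrite leqnSn.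
  have := joint_left q (mZ 0) (mX 0) rho01 (PZ 0) (PZX 0) zv zz.
  by rewrite !Fz// ?(ltnW vN)// -mulrBl jump.
have high v : (v < N')%N -> J v.+2 - J v.+1 <= sl (z v.+1) / N'.+1%:R.
  move=> vN; have zv := z01 v.+1 vN; rewrite /J /= vN.
  case: ifPn => [vN2|].
    have zz : z v.+1 <= z v.+2 by apply: z_mono => //; rewrite leqnSn.
    have := joint_right q (mZ 0) (mX 0) rho01 (PZ 0) (PZX 0) zv zz.
    by rewrite !Fz// -mulrBl jump.
  rewrite -ltnNge ltnS => N2; have N'E : N' = v.+1 by apply/eqP; rewrite eqn_leq N2.
  have := joint_righty q (mZ 0) (mX 0) rho01 (PZ 0) (PX 0) (PZX 0) zv.
  rewrite Fz// -[X in X - _ / _](@divff _ N'.+1%:R) ?gt_eqF// -mulrBl.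
  by rewrite -N'E jump.
exists (cell_miss N' J); split.
- exact: cell_miss_bound hL hJ.
- move=> u v; elim: v => [|v IH]; first by rewrite leqn0 => /andP[/eqP -> _].
  rewrite leq_eqVlt => /andP[/predU1P[-> //|uv] vN].
  apply: le_trans (IH _) _; first by rewrite -ltnS uv ltnW.
  by rewrite /cell_miss lerD2l lerN2 (le_trans (high v vN))// low.
- by move=> M' m n nM; exact: (miss_event_approx mZ mX ind z_mono hL hJ).
- move=> eps delta h v vN vd.
  rewrite /cell_miss lerBlDr -lerBlDl; apply: le_trans (low v vN).
  rewrite -[X in X - _]mul1r -mulrBl ler_pM2r ?invr_gt0//.
  by apply: h; [exact: z01|rewrite Fz].
Qed.

Definition miss (m n : nat) : R := fine (P (miss_event Z X q m n)).

Lemma miss_nonincreasing m n n' : (0 < m)%N -> (m <= n)%N -> (n <= n')%N ->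
  miss m n' <= miss m n.
Proof.
move=> m0 mn; case: n' => [|M'] nn'; first by rewrite leqNgt (leq_trans m0 mn) in nn'.
apply/ler_addgt0Pr => e e0.
have e20 : 0 < e / 2 by rewrite divr_gt0.
(* One discretisation of [n'] points serves both sample sizes; each of the two approximation errors
   is at most [e / 2]. *)
have [N' _ Ne] := @exists_inv_nat_le R (M'.+1%:R * M'.+1%:R) (e / 2) 0 e20.
have [w0 [w0b w0m appr _]] := discretisation N'.
have := appr M' m _ nn'; rewrite ler_distl => /andP[h1 _].
have := appr M' m _ (leqnn M'.+1); rewrite ler_distl => /andP[_ h2].
have := bad_prob_nonincreasing w0b w0m mn nn' (leqnn _).
set E := _ / N'.+1%:R in Ne h1 h2 *; rewrite /miss => h3.
have := le_trans h2 (lerD h3 Ne); move: h1 Ne; move: (fine _) (fine _) (bad_prob _ _ _ _ _) => x y t.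
lra.
Qed.

Lemma miss_small m eps : 0 < FX q -> (0 < m)%N -> 0 < eps ->
  exists K, forall n, (K <= n)%N -> miss m n <= eps.
Proof.
move=> q0 m0 eps0; have e0 : 0 < eps / 3 by lra.
have [delta' d'0 near'] := slope_near1 FZ rho01 q0 e0.
(* The cap at one half keeps the number [u] of tail cells at most [N'] and the ratio [1 - delta / 2]
   nonnegative. *)
pose delta := minr delta' 2^-1.
have d0 : 0 < delta by rewrite lt_min d'0; lra.
have d2 : delta <= 2^-1 by rewrite ge_min lexx orbT.
have near z : 0 < FZ z < 1 -> FZ z <= delta -> 1 - eps / 3 <= sl z.
  by move=> z01; rewrite le_min => /andP[/near' h _]; exact: h.
have bound n : (m <= n)%N -> miss m n <= eps / 3 + (1 - delta / 2) ^+ n.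
  case: n => [|M'] mn; first by rewrite leqNgt m0 in mn.
  apply/ler_addgt0Pr => e e0'.
  have [k _ kd] := @exists_inv_nat_le R 2 delta 0 d0.
  have [N' kN Ne] := @exists_inv_nat_le R (M'.+1%:R * M'.+1%:R) e k e0'.
  have [w0 [w0b w0m appr small]] := discretisation N'.
  have N0 : 0 < N'.+1%:R :> R by [].
  have dN : 2 <= delta * N'.+1%:R.
    move: kd; rewrite ler_pdivrMr// => /le_trans; apply.
    by rewrite ler_pM2l// ler_nat ltnS.
  (* Cells [0] to [u.-1] lie in the left tail of mass [delta]; [bad_prob_le] is used at [v0 = u.-1],
     so that [v0.+1 = u]. *)
  pose u := Num.truncn (delta * N'.+1%:R).
  have /andP[u1 u2] : u%:R <= delta * N'.+1%:R < u.+1%:R.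
    by apply: truncn_itv; rewrite mulr_ge0// ltW.
  have u0 : (0 < u)%N.
    by rewrite -ltnS -(ltr_nat R) (le_lt_trans _ u2)// (le_trans _ dN)// ler_nat.
  have uN : (u <= N')%N.
    rewrite -ltnS -(ltr_nat R) (le_lt_trans u1)// gtr_pMl//; lra.
  have := appr M' m _ (leqnn _); rewrite ler_distl => /andP[_ h].
  have := @bad_prob_le R N' M' w0 w0b w0m m u.-1.
  rewrite m0 mn prednK// => /(_ isT (leq_trans uN (leqnSn _))) h'.
  have := small _ _ near u.-1; rewrite prednK// => /(_ uN).
  rewrite ler_pdivrMr// => /(_ u1) h''.
  apply: (le_trans h); apply: lerD => //; apply: (le_trans h'); apply: lerD.
    by rewrite invrK -ler_pdivlMr.
  (* Rounding down costs less than 1, which is at most half of [delta * N'.+1] by [dN]. *)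
  have ud : delta / 2 <= u%:R / N'.+1%:R.
    rewrite ler_pdivlMr//; rewrite -natr1 in u2; lra.
  have ud1 : (u%:R / N'.+1%:R : R) <= 1.
    by rewrite ler_pdivrMr// mul1r ler_nat (leq_trans uN).
  rewrite lerXn2r ?nnegrE ?subr_ge0// ?lerD2l ?lerN2//; lra.
have : (fun n => (1 - delta / 2) ^+ n) @ \oo --> (0 : R).
  by apply: cvg_expr; rewrite ger0_norm; lra.
move=> /cvgrPdist_le/(_ _ e0)[K _ hK].
exists (maxn m K) => n; rewrite geq_max => /andP[mn Kn].
apply: (le_trans (bound n mn)); have := hK n Kn; rewrite /= sub0r normrN => h.
have := le_trans (ler_norm _) h; lra.
Qed.

End fixed_level.

Lemma quantile_gtNy (alpha : R) : 0 < alpha -> quantile FX alpha != -oo%E.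
Proof.
move=> a0; apply/eqP => h; have : (alpha%:E <= 0)%E.
  apply: (prob_le_nat_lb (P := P) (mX 0)) => k.
  have : (quantile FX alpha < (- k%:R)%:E)%E by rewrite h ltNyr.
  move=> /ereal_inf_lt[_ [x /= ax <-]]; rewrite lte_fin => xk.
  by rewrite PX lee_fin (le_trans ax)// (cdf_mono (mX 0) (PX 0))// ltW.
by rewrite lee_fin leNgt a0.
Qed.

(** Right continuity of the distribution function of [X]: the infimum is attained. *)
Lemma quantile_le (alpha q : R) : quantile FX alpha = q%:E -> alpha <= FX q.
Proof.
move=> h; rewrite -lee_fin -(PX 0).
apply: (prob_le_right (P := P) (mX 0)) => t qt.
have : (quantile FX alpha < t%:E)%E by rewrite h lte_fin.
move=> /ereal_inf_lt[_ [x /= ax <-]]; rewrite lte_fin => xt.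
by rewrite PX lee_fin (le_trans ax)// (cdf_mono (mX 0) (PX 0))// ltW.
Qed.

Lemma bigmin_le (q : R) (s : seq nat) (x : nat -> R) :
  (\big[Order.min/+oo%E]_(j <- s) (x j)%:E <= q%:E)%E = has (fun j => x j <= q) s.
Proof.
elim: s => [|j s IH]; first by rewrite big_nil /= leye_eq.
by rewrite big_cons ge_min lee_fin IH.
Qed.

Lemma p_successE (alpha q : R) (m n : nat) : quantile FX alpha = q%:E ->
  p_success P Z X FX n m alpha = (1 - miss q m n)%:E.
Proof.
move=> h; have mM := measurable_miss_event mZ mX q m (leqnSn n).
rewrite /miss EFinB fineK ?fin_prob// -(probability_setC P mM).
rewrite /p_success h; congr (P _); apply/seteqP; split => w; rewrite /miss_event /= bigmin_le.
  by move=> /hasP[j js xq] nh; have := nh j js; rewrite ltNge xq.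
move=> nh; apply/negPn/negP => /hasPn nh'; apply: nh => j js.
by rewrite ltNge nh'.
Qed.

End copula_model.

Theorem mainTheorem8 (R : realType) (d : measure_display) (T : measurableType d)
    (P : probability T R) (Z X : nat -> T -> R) (FZ FX : R -> R)
    (m : nat) (alpha rho : R) :
  gaussian_copula_iid P Z X FZ FX rho ->
  (0 < m)%N -> 0 < alpha <= 1 -> 0 < rho <= 1 ->
  (forall n n' : nat, (m <= n)%N -> (n <= n')%N ->
     (p_success P Z X FX n m alpha <= p_success P Z X FX n' m alpha)%E) /\
  ((fun n : nat => p_success P Z X FX n m alpha) @ \oo --> 1%E).
Proof.
move=> model m0 /andP[a0 _] rho01.
case Q : (quantile FX alpha) => [q| |]; last first.
- by have := quantile_gtNy model a0; rewrite Q eqxx.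
(* An infinite quantile, possible for [alpha = 1], makes the success event the whole space. *)
- have p1 n : p_success P Z X FX n m alpha = 1%E.
    rewrite /p_success Q -(probability_setT P); congr (P _).
    by apply/seteqP; split => // w _ /=; rewrite leey.
  split=> [n n' _ _|]; first by rewrite !p1.
  by under eq_fun do rewrite p1; exact: cvg_cst.
have FXq : 0 < FX q by rewrite (lt_le_trans a0)// (quantile_le model Q).
have pE n : p_success P Z X FX n m alpha = (1 - miss P Z X q m n)%:E.
  exact: (p_successE model m n Q).
split=> [n n' mn nn'|].
  by rewrite !pE lee_fin lerD2l lerN2 (miss_nonincreasing model rho01).
rewrite (_ : (fun n => _) = EFin \o (fun n => 1 - miss P Z X q m n)); last first.
  by apply/funext => n /=; exact: pE.
apply: cvg_EFin; first by apply: nearW.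
apply/cvgrPdist_le => eps eps0 /=.
have [K hK] := miss_small model rho01 FXq m0 eps0.
near=> n; rewrite subKr ger0_norm; last exact: fine_ge0.
by apply: hK; near: n; exact: nbhs_infty_ge.
Unshelve. all: by end_near. Qed.
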